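(* There exists a constant $R\ge1$ such that for all $s\in\mathbb N$, $\boldsymbol\nu\in\mathbb N_0^s\setminus\{\mathbf 0\}$ and $\boldsymbol\eta\in\mathbb N_0^k\setminus\{\mathbf 0\}$ there holds $$ \big|\partial_{\boldsymbol y}^{\boldsymbol\eta}\partial_{\boldsymbol\theta}^{\boldsymbol\nu}\,{\rm e}^{-\frac12\|\boldsymbol y-G_s(\boldsymbol\theta,\boldsymbol\xi)\|_{\Gamma^{-1}}^2}\big|\leq 1.1^k\cdot 2^{\beta(k-1)}\,k\,{\rm e}^{2k}\,\boldsymbol\eta!\,(4^{\beta}C)^{|\boldsymbol\nu|}\,\mu_{\min}^{-|\boldsymbol\nu|-1/2}\,R^{|\boldsymbol\nu|}\,(|\boldsymbol\nu|!)^{\beta}\,\boldsymbol b^{\boldsymbol\nu} $$ for all $\boldsymbol\theta\in\Theta_s$, $\boldsymbol y\in[-K,K]^k$, and $\boldsymbol\xi\in\Xi$.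
   Context: Notation: for multi-indices, $|\boldsymbol\nu|=\sum_j\nu_j$, $\boldsymbol\eta!=\prod_j\eta_j!$, $\boldsymbol b^{\boldsymbol\nu}=\prod_{j} b_j^{\nu_j}$ (with $0^0=1$), $\partial_{\boldsymbol\theta}^{\boldsymbol\nu}=\prod_j\partial^{\nu_j}/\partial\theta_j^{\nu_j}$, and similarly $\partial_{\boldsymbol y}^{\boldsymbol\eta}$. $\|\cdot\|$ is the Euclidean norm and $\|\boldsymbol x\|_{\Gamma^{-1}}=\sqrt{\boldsymbol x^{\rm T}\Gamma^{-1}\boldsymbol x}$. Standing assumptions: $k\in\mathbb N$, $K>0$; $\Xi$ is a compact subset of a Euclidean space (design space); $\Theta_s=[-\frac12,\frac12]^s$. $\Gamma\in\mathbb R^{k\times k}$ is symmetric positive definite and $0<\mu_{\min}\le 1$ is a lower bound on its smallest eigenvalue. $C\ge1$ and $\beta\ge1$ are constants and $\boldsymbol b=(b_j)_{j\ge1}\in\ell^p(\mathbb N)$, for some $p\in(0,1)$, is a sequence of nonnegative real numbers, all independent of $s$ and $\boldsymbol\xi$. The forward models $G_s:\Theta_s\times\Xi\to\mathbb R^k$, $s\in\mathbb N$, are smooth in $\boldsymbol\theta$ and satisfy $\|\partial_{\boldsymbol\theta}^{\boldsymbol\nu}G_s(\boldsymbol\theta,\boldsymbol\xi)\|\le C(|\boldsymbol\nu|!)^{\beta}\boldsymbol b^{\boldsymbol\nu}$ for all $\boldsymbol\theta\in\Theta_s$, $\boldsymbol\nu\in\mathbb N_0^s$, $\boldsymbol\xi\in\Xi$.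 *)

(* Defs.v *)
From HB Require Import structures.
From mathcomp Require Import all_boot all_order all_algebra.
From mathcomp Require Import all_classical all_reals all_analysis.
Import Order.TTheory GRing.Theory Num.Theory.
Import numFieldNormedType.Exports.

Set Implicit Arguments.
Unset Strict Implicit.
Unset Printing Implicit Defensive.

Local Open Scope classical_set_scope.
Local Open Scope ring_scope.

(* Vectors of R^n are row vectors 'rV[R]_n. The library norm `|x| on 'rV[R]_n
   is the sup norm, hence the explicit Euclidean norm. *)
Definition enorm (R : realType) (n : nat) (x : 'rV[R]_n) : R :=
  Num.sqrt (\sum_(i < n) x 0 i ^+ 2).

Definition wnorm (R : realType) (n : nat) (A : 'M[R]_n) (x : 'rV[R]_n) : R :=
  Num.sqrt ((x *m A *m x^T) 0 0).

Definition posdefmx (R : realType) (n : nat) (A : 'M[R]_n) : Prop :=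
  A^T = A /\ forall x : 'rV[R]_n, x != 0 -> 0 < (x *m A *m x^T) 0 0.

Definition lp_seq (R : realType) (p : R) (b : R^nat) : Prop :=
  cvgn (series (fun j => `|b j| `^ p)).

Definition cube (R : realType) (n : nat) (a : R) : set 'rV[R]_n :=
  [set x | forall i, - a <= x 0 i <= a].

Definition mlength (n : nat) (nu : {ffun 'I_n -> nat}) : nat :=
  (\sum_(j < n) nu j)%N.

Definition mfact (n : nat) (nu : {ffun 'I_n -> nat}) : nat :=
  (\prod_(j < n) (nu j)`!)%N.

(* b`_j of the sequence (b_j)_(j >= 1) is stored at index j - 1. *)
Definition mpow (R : realType) (b : R^nat) (n : nat)
    (nu : {ffun 'I_n -> nat}) : R :=
  \prod_(j < n) b j ^+ nu j.

(* Directional derivatives relative to a set D, so that a function only defined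
   on a closed cube can be differentiated at boundary points (one-sidedly):
   the definition of the library's 'D_v f x, with the increments h restricted
   to those for which x + h v stays in D. *)
Section derive_in.
Context {R : realType} {V W : normedModType R}.
Implicit Types (D : set V) (v x : V) (f : V -> W).

Definition increments_in D v x : set_system R :=
  within [set h | D (h *: v + x)] 0^'.

Definition derive_in D v f x : W :=
  lim ((fun h => h^-1 *: ((f \o shift x) (h *: v) - f x))
       @ increments_in D v x).

Definition derivable_in D v f x : Prop :=
  cvg ((fun h => h^-1 *: ((f \o shift x) (h *: v) - f x))
       @ increments_in D v x).

Lemma increments_in_interior D v x : D° x -> increments_in D v x = 0^'.
Proof.
move=> Dx; apply/seteqP; split => A; last first.
  by rewrite /increments_in /within /= => A0; near=> h => _; near: h.
rewrite /increments_in /within /= => A0.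
have D0 : \forall h \near (0 : R), D (h *: v + x).
  have cf : h *: v + x @[h --> (0 : R)] --> 0 *: v + x.
    by apply: cvgD; [exact: scalel_continuous|exact: cvg_cst].
  by rewrite scale0r add0r in cf; exact: cf Dx.
have D0' : \forall h \near (0 : R)^', D (h *: v + x) by exact: cvg_within D0.
by apply: filterS2 A0 D0' => h /[apply].
Unshelve. all: by end_near. Qed.

Lemma derive_in_interior D v f x : D° x -> derive_in D v f x = 'D_v f x.
Proof. by move=> Dx; rewrite /derive_in increments_in_interior. Qed.

Lemma derive_inT v f : derive_in setT v f = 'D_v f.
Proof. by apply/funext => x; rewrite derive_in_interior // interiorT. Qed.

End derive_in.

Section partial_derivatives.
Context {R : realType} {n : nat} {W : normedModType R}.
Implicit Types (D : set 'rV[R]_n) (f : 'rV[R]_n -> W).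

(* partials D [:: j1; ...; jm] f is d_(j1) (... (d_(jm) f)). *)
Definition partials D (l : seq 'I_n) f : 'rV[R]_n -> W :=
  foldr (fun j g => derive_in D (delta_mx 0 j) g) f l.

Definition mindex_seq (nu : {ffun 'I_n -> nat}) : seq 'I_n :=
  flatten [seq nseq (nu j) j | j <- enum 'I_n].

Definition mpartial D (nu : {ffun 'I_n -> nat}) f : 'rV[R]_n -> W :=
  partials D (mindex_seq nu) f.

(* C^oo on D: the partial derivatives of all orders exist at every point of D
   and are continuous on D. *)
Definition smooth_in D f : Prop :=
  forall l : seq 'I_n,
    {within D, continuous (partials D l f)} /\
    forall (j : 'I_n) x, D x ->
      derivable_in D (delta_mx 0 j) (partials D l f) x.

End partial_derivatives.

(* Main.v *)
Require Import Defs.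
From HB Require Import structures.
From mathcomp Require Import all_boot all_order all_algebra.
From mathcomp Require Import all_classical all_reals all_analysis.
From mathcomp Require Import ring lra.
Import Order.TTheory GRing.Theory Num.Theory.
Import numFieldNormedType.Exports.
Local Open Scope classical_set_scope.
Local Open Scope ring_scope.

Set Implicit Arguments.
Unset Strict Implicit.
Unset Printing Implicit Defensive.

(* With F(z) = exp(- z^T Gamma^-1 z / 2), the theta-derivatives of F(y - G) are
   given by Faa di Bruno's formula: a sum of monomials, each a derivative of F
   of order m times m derivatives of G, and differentiating in y only raises
   the order of the derivative of F. Differentiating the product
   dF = - (Gamma^-1 z) F gives a Hermite-type recursion for the derivatives of
   F, so that those of order n are O(eps^n n!) on bounded sets for every
   eps > 0. With eps = 1 / (2k), the factor (m + |eta|)! is at most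
   2^(m + |eta|) m! k^|eta| eta!, which leaves eta! m! / k^m up to a constant.
   One theta-derivative multiplies the total weight of the monomials of order n
   by at most 3 C b_j (n + 1)^beta, so the total is (3C)^n (n!)^beta b^nu.
   Multi-indices are handled as sorted lists: a block of Faa di Bruno's formula
   is a sublist, hence again sorted, so partial derivatives never have to be
   exchanged. *)

(** * Calculus of directional derivatives relative to a set *)

Section has_derive_in.
Context {R : realType} {V : normedModType R}.
Implicit Types (D : set V) (v x : V) (f g : V -> R).

(** Bundles existence of the limit with its value, so that the differentiation rules compose without
    separate differentiability conditions. *)
Definition has_derive_in D v f x (a : R) : Prop :=
  (fun h : R => h^-1 * (f (h *: v + x) - f x)) @ increments_in D v x --> a.

#[global] Instance increments_in_filter D v x : Filter (increments_in D v x).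
Proof. exact: within_filter. Qed.

(** Properness makes the limit unique: if no small nonzero increment stayed in [D], the filter would
    be trivial and every number would be a limit. *)
Lemma derive_in_has_derive D v (f : V -> R) x a :
  ProperFilter (increments_in D v x) ->
  has_derive_in D v f x a -> derive_in D v (f : V -> R) x = a.
Proof. by move=> pF fa; apply: cvg_lim. Qed.

Lemma near_increments_in_neq0 D v x : \forall h \near increments_in D v x, h != 0.
Proof.
by apply: cvg_within; rewrite /= /dnbhs /prop_near1; exact: withinT.
Qed.

Lemma near_increments_in D v x : \forall h \near increments_in D v x, D (h *: v + x).
Proof. exact: withinT. Qed.

Lemma cvg_increments_in D v x : h @[h --> increments_in D v x] --> (0 : R).
Proof.
exact: cvg_trans (@cvg_within _ _ _ _) (@cvg_within _ _ _ _).
Qed.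

(** Only values on [D] enter the difference quotients, so a formula established on [D] alone can be
    differentiated again. *)
Lemma eq_has_derive_in D v f g x a : D x -> {in D, f =1 g} ->
  has_derive_in D v f x a -> has_derive_in D v g x a.
Proof.
move=> Dx fg; apply: cvg_trans; apply: near_eq_cvg.
near=> h; rewrite !fg ?inE//.
by near: h; exact: near_increments_in.
Unshelve. all: by end_near. Qed.

Lemma has_derive_in_cst D v x (c : R) : has_derive_in D v (fun=> c) x 0.
Proof.
rewrite /has_derive_in; under eq_fun do rewrite subrr mulr0.
exact: cvg_cst.
Qed.

Lemma has_derive_inD D v f g x a c : has_derive_in D v f x a ->
  has_derive_in D v g x c -> has_derive_in D v (fun t => f t + g t) x (a + c).
Proof.
move=> fa gc; rewrite /has_derive_in.
under eq_fun do rewrite opprD addrACA mulrDr.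
exact: cvgD.
Qed.

Lemma has_derive_in_continuous D v f x a : has_derive_in D v f x a ->
  f (h *: v + x) @[h --> increments_in D v x] --> f x.
Proof.
move=> fa; rewrite -[X in _ --> X](addr0 (f x)) -(mul0r a).
have : (fun h => f x + h * (h^-1 * (f (h *: v + x) - f x))) @ increments_in D v x
    --> f x + 0 * a.
  by apply: cvgD; [exact: cvg_cst | apply: cvgM => //; exact: cvg_increments_in].
apply: cvg_trans; apply: near_eq_cvg; near=> h.
rewrite /= mulrA divff ?mul1r 1?addrC ?subrK//.
by near: h; exact: near_increments_in_neq0.
Unshelve. all: by end_near. Qed.

Lemma has_derive_inM D v f g x a c : has_derive_in D v f x a ->
  has_derive_in D v g x c ->
  has_derive_in D v (fun t => f t * g t) x (a * g x + f x * c).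
Proof.
move=> fa gc; rewrite /has_derive_in.
have -> : (fun h => h^-1 * (f (h *: v + x) * g (h *: v + x) - f x * g x)) =
  (fun h => h^-1 * (f (h *: v + x) - f x) * g (h *: v + x) +
     f x * (h^-1 * (g (h *: v + x) - g x))).
  by apply/funext => h; ring.
apply: cvgD; last by apply: cvgM => //; exact: cvg_cst.
by apply: cvgM => //; exact: has_derive_in_continuous gc.
Qed.

Lemma has_derive_in_expR D v f x a : has_derive_in D v f x a ->
  has_derive_in D v (fun t => expR (f t)) x (expR (f x) * a).
Proof.
(* Caratheodory's form of the derivative writes the increment of [expR] as a continuous factor times
   the increment of [f], which avoids dividing by an increment of [f] that may vanish. *)
move=> fa; have [h [hE hC hx]] :=
  (is_derive1_caratheodory _ _ _).1 (is_derive_expR (f x)).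
rewrite /has_derive_in.
under eq_fun do rewrite hE mulrCA.
apply: cvgM => //; rewrite -hx.
exact: cvg_comp (has_derive_in_continuous fa) hC.
Qed.

Lemma has_derive_in_sum D v x (I : eqType) (r : seq I) (f : I -> V -> R)
    (a : I -> R) : (forall i, i \in r -> has_derive_in D v (f i) x (a i)) ->
  has_derive_in D v (fun t => \sum_(i <- r) f i t) x (\sum_(i <- r) a i).
Proof.
elim: r => [|i r IH] fa.
  rewrite big_nil (_ : (fun t => _) = fun=> 0); first exact: has_derive_in_cst.
  by apply/funext => t; rewrite big_nil.
rewrite big_cons (_ : (fun t => _) =
  fun t => f i t + \sum_(i <- r) f i t); last first.
  by apply/funext => t; rewrite big_cons.
apply: has_derive_inD; first by apply: fa; rewrite mem_head.
by apply: IH => l lr; apply: fa; rewrite in_cons lr orbT.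
Qed.

Lemma has_derive_inZ D v f x a c : has_derive_in D v f x a ->
  has_derive_in D v (fun t => c * f t) x (c * a).
Proof.
move=> fa; have := has_derive_inM (has_derive_in_cst D v x c) fa.
by rewrite mul0r add0r.
Qed.

Lemma has_derive_inN D v f x a : has_derive_in D v f x a ->
  has_derive_in D v (fun t => - f t) x (- a).
Proof.
move=> fa; have := has_derive_inZ (c := -1) fa; rewrite mulN1r.
by congr has_derive_in; apply/funext => t; rewrite mulN1r.
Qed.

End has_derive_in.

Lemma has_derive_in_coord {R : realType} {V : normedModType R} (k : nat)
    (D : set V) v x (f : V -> 'rV[R]_k) (i : 'I_k) :
  derivable_in D v f x ->
  has_derive_in D v (fun t => f t 0 i) x (derive_in D v f x 0 i).
Proof.
move=> df.
have := @cvg_comp _ _ _ _ _ _ _ _ df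
  (@coord_continuous R 1 k 0 i (derive_in D v f x)).
rewrite /has_derive_in; apply: cvg_trans.
by apply: near_eq_cvg; apply: nearW => h; rewrite /= !mxE.
Qed.

Lemma has_derive_in_proj {R : realType} (n : nat) (D : set 'rV[R]_n) x (i j : 'I_n) :
  has_derive_in D (delta_mx 0 j) (fun t : 'rV[R]_n => t 0 i) x (i == j)%:R.
Proof.
have : (fun=> (i == j)%:R : R) @ increments_in D (delta_mx 0 j) x
    --> ((i == j)%:R : R).
  exact: cvg_cst.
rewrite /has_derive_in; apply: cvg_trans; apply: near_eq_cvg; near=> h.
rewrite !mxE eqxx /= addrK mulrA mulVf ?mul1r//.
by near: h; exact: near_increments_in_neq0.
Unshelve. all: by end_near. Qed.

Lemma increments_in_setT_proper {R : realType} {V : normedModType R} (v x : V) :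
  ProperFilter (increments_in setT v x).
Proof.
rewrite increments_in_interior ?interiorT//; exact: Proper_dnbhs_numFieldType.
Qed.

(** Small enough steps along coordinate [j] towards the centre never leave the cube, even from a
    face or a corner; hence the sign of [h] is opposite to that of [x 0 j]. *)
Lemma increments_in_cube_proper {R : realType} (n : nat) (a : R) (x : 'rV[R]_n) j :
  0 < a -> cube a x -> ProperFilter (increments_in (cube a) (delta_mx 0 j) x).
Proof.
move=> a0 ax; apply: Build_ProperFilter_ex => P.
move=> /nbhs_ballP[e /= e0 eP].
pose d := Num.min (e / 2) a.
have d0 : 0 < d by rewrite lt_min a0 divr_gt0.
pose h := if 0 <= x 0 j then - d else d.
exists h; apply: eP => /=.
- rewrite /ball /= sub0r normrN /h.
  have : `|d| < e by rewrite gtr0_norm// gt_min; apply/orP; left; lra.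
  by case: ifP; rewrite ?normrN.
- by rewrite /h; case: ifP; rewrite ?oppr_eq0 gt_eqF.
- move=> i; rewrite !mxE eqxx /=.
  have := ax i; case: (eqVneq i j) => [->|_]; last by rewrite mulr0 add0r.
  rewrite mulr1 /h; have : d <= a by rewrite ge_min lexx orbT.
  by case: ifPn => //; rewrite -?ltNge; lra.
Qed.

(** * Iterated partial derivatives of the Gaussian *)

(** Positions rather than values are removed, so repeated entries count with multiplicity, as the
    Leibniz rule requires. *)
Fixpoint removals (T : Type) (s : seq T) : seq (T * seq T) :=
  if s is x :: s' then (x, s') :: [seq (p.1, x :: p.2) | p <- removals s'] else [::].

Lemma removals_rcons (T : Type) (s : seq T) x :
  removals (rcons s x) = rcons [seq (p.1, rcons p.2 x) | p <- removals s] (x, s).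
Proof.
elim: s => //= y s ->; rewrite map_rcons -!map_comp /=; congr (_ :: rcons _ _).
Qed.

Lemma size_removals (T : Type) (s : seq T) : size (removals s) = size s.
Proof. by elim: s => //= x s IH; rewrite size_map IH. Qed.

Lemma removals_size (T : eqType) (s : seq T) p :
  p \in removals s -> (size p.2).+1 = size s.
Proof.
elim: s p => //= x s IH p; rewrite in_cons => /predU1P[-> //|/mapP[q qs ->]] /=.
by rewrite IH.
Qed.

Section gaussian.
Context {R : realType} {k : nat} (A : 'M[R]_k).
Implicit Types (I : seq 'I_k) (z : 'rV[R]_k).

Definition lform i z : R := \sum_j A i j * z 0 j.
Definition qform z : R := \sum_i z 0 i * lform i z.

(* gaussD I is the iterated partial derivative of expR (- qform / 2) along I.
   The recursion differentiates d_i F = - lform i * F along the tail of I by the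
   Leibniz rule, which stops after one derivative of the linear form. *)
Fixpoint gaussD_rec n I z : R :=
  match n, I with
  | n'.+1, i :: I' => - lform i z * gaussD_rec n' I' z
      - \sum_(p <- removals I') A i p.1 * gaussD_rec n' p.2 z
  | _, _ => expR (- 2^-1 * qform z)
  end.

Definition gaussD I := gaussD_rec (size I) I.

(** The first argument is fuel, because the lists [p.2] are no subterms of [I]. Every recursive call
    is on a shorter list, so surplus fuel does not change the value. *)
Lemma gaussD_recE n I z : (size I <= n)%N -> gaussD_rec n I z = gaussD I z.
Proof.
rewrite /gaussD; have [m mn] := ubnP (size I).
elim: m n I mn => // m IH [|n] [|i I] //= nm In.
congr (_ * _ - _); first exact: IH.
apply: eq_big_seq => p /removals_size pI; congr (_ * _).
have ltm : (size p.2 < m)%N by rewrite pI ltnW.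
by transitivity (gaussD_rec (size p.2) p.2 z); [|symmetry]; apply: IH => //;
  rewrite -ltnS pI // ltnW.
Qed.

Lemma gaussD_cons i I z : gaussD (i :: I) z =
  - lform i z * gaussD I z - \sum_(p <- removals I) A i p.1 * gaussD p.2 z.
Proof.
rewrite {1}/gaussD /=; congr (_ - _).
apply: eq_big_seq => p /removals_size pI.
by rewrite gaussD_recE// -pI.
Qed.

Context {V : normedModType R} (D : set V) (v x : V).
Context (f : V -> 'rV[R]_k) (a : 'I_k -> R).
Hypothesis fa : forall i, has_derive_in D v (fun t => f t 0 i) x (a i).
Hypothesis A_sym : A^T = A.

Lemma has_derive_lform i :
  has_derive_in D v (fun t => lform i (f t)) x (\sum_j A i j * a j).
Proof. by apply: has_derive_in_sum => j _; exact: has_derive_inZ. Qed.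

(** The product rule yields two sums, which coincide by the symmetry of [A]; hence the factor 2. *)
Lemma has_derive_qform :
  has_derive_in D v (fun t => qform (f t)) x (2 * \sum_j lform j (f x) * a j).
Proof.
have -> : 2 * (\sum_j lform j (f x) * a j) =
   \sum_i (a i * lform i (f x) + f x 0 i * \sum_j A i j * a j).
  rewrite big_split /= mulr2n mulrDl !mul1r; congr (_ + _).
    by apply: eq_bigr => j _; rewrite mulrC.
  under [RHS]eq_bigr do rewrite mulr_sumr.
  rewrite exchange_big /=; apply: eq_bigr => j _; rewrite mulr_suml.
  by apply: eq_bigr => i _; rewrite -[in LHS]A_sym mxE; ring.
apply: has_derive_in_sum => i _; apply: has_derive_inM => //.
exact: has_derive_lform.
Qed.

(** The chain rule, with the new index appended at the end while the recursion works at the front.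
    Strong induction on the size is used because the recursion also visits the lists [p.2]. *)
Lemma has_derive_gaussD I : has_derive_in D v (fun t => gaussD I (f t)) x
  (\sum_j gaussD (rcons I j) (f x) * a j).
Proof.
have [n nI] := ubnP (size I); elim: n I nI => // n IH [|i I] /= nI.
  have -> : \sum_j gaussD (rcons [::] j) (f x) * a j =
     expR (- 2^-1 * qform (f x)) * (- 2^-1 * (2 * \sum_j lform j (f x) * a j)).
    have : forall j, gaussD [:: j] (f x) =
        - lform j (f x) * expR (- 2^-1 * qform (f x)).
      by move=> j; rewrite gaussD_cons big_nil subr0.
    move: (expR _) => e eE; rewrite !mulr_sumr; apply: eq_bigr => j _.
    by rewrite /= eE; field.
  apply: has_derive_in_expR; apply: has_derive_inZ; exact: has_derive_qform.
have -> : (fun t => gaussD (i :: I) (f t)) =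
  (fun t => - lform i (f t) * gaussD I (f t) +
      - \sum_(p <- removals I) A i p.1 * gaussD p.2 (f t)).
  by apply/funext => t; rewrite gaussD_cons.
have -> : \sum_j gaussD (rcons (i :: I) j) (f x) * a j =
   ((- \sum_j A i j * a j) * gaussD I (f x) +
    - lform i (f x) * (\sum_j gaussD (rcons I j) (f x) * a j))
   + - \sum_(p <- removals I) A i p.1 * \sum_j gaussD (rcons p.2 j) (f x) * a j.
  have -> : \sum_(p <- removals I) A i p.1 *
      (\sum_j gaussD (rcons p.2 j) (f x) * a j) =
    \sum_j \sum_(p <- removals I) A i p.1 * gaussD (rcons p.2 j) (f x) * a j.
    rewrite exchange_big /=; apply: eq_bigr => p _; rewrite mulr_sumr.
    by apply: eq_bigr => j _; rewrite mulrA.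
  (* A removal from [rcons I j] takes either [j], giving the derivative [A i j] of the linear form
     times [gaussD I], or an entry of [I], giving a term of the induction hypothesis for [p.2]. *)
  under eq_bigr => j _ do
    rewrite rcons_cons gaussD_cons removals_rcons big_rcons big_map /=.
  move: (lform i _) => l.
  rewrite mulNr mulr_suml mulr_sumr -sumrN -big_split -sumrB.
  apply: eq_bigr => j _ /=.
  by rewrite -mulr_suml; ring.
apply: has_derive_inD.
  apply: has_derive_inM; last exact: IH.
  by apply: has_derive_inN; exact: has_derive_lform.
apply: has_derive_inN.
apply: has_derive_in_sum => p /removals_size pI.
by apply: has_derive_inZ; apply: IH; rewrite -pI in nI; exact: ltnW.
Qed.

End gaussian.

(** * Growth of the Hermite-type recursion *)

(** For [alpha = -1] this is the recursion of the probabilists' Hermite polynomials in [a];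
    nonnegative [alpha] makes it a majorant for the derivatives of the Gaussian. *)
Fixpoint hermite_bound {R : realType} (a alpha : R) n : R :=
  match n with
  | 0 => 1
  | n'.+1 => a * hermite_bound a alpha n' +
      match n' with 0 => 0 | n''.+1 => alpha * n'%:R * hermite_bound a alpha n'' end
  end.

Lemma hermite_boundSS {R : realType} (a alpha : R) n : hermite_bound a alpha n.+2 =
  a * hermite_bound a alpha n.+1 + alpha * n.+1%:R * hermite_bound a alpha n.
Proof. by []. Qed.

(** A crude rate, needed only for the finitely many orders that precede the regime of rate [eps].
    Two consecutive orders are carried through the induction. *)
Lemma hermite_bound_geometric {R : realType} (a alpha c : R) n :
  0 <= a -> 0 <= alpha -> 1 <= c -> a + alpha <= c ->
  hermite_bound a alpha n <= c ^+ n * n`!%:R.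
Proof.
move=> a0 alpha0 c1 ac; have c0 : 0 <= c by apply: le_trans c1.
suff : hermite_bound a alpha n <= c ^+ n * n`!%:R /\
       hermite_bound a alpha n.+1 <= c ^+ n.+1 * n.+1`!%:R by case.
elim: n => [|n [IH1 IH2]].
  rewrite /= (erefl : 1`! = 1)%N fact0 expr0 expr1 mulr1 addr0 !mulr1.
  by split=> //; lra.
split=> //; rewrite hermite_boundSS.
apply: (@le_trans _ _
    (a * (c ^+ n.+1 * n.+1`!%:R) + alpha * n.+1%:R * (c ^+ n * n`!%:R))).
  by apply: lerD; apply: ler_wpM2l; rewrite ?mulr_ge0.
have -> : a * (c ^+ n.+1 * n.+1`!%:R) + alpha * n.+1%:R * (c ^+ n * n`!%:R) =
  c ^+ n * n.+1`!%:R * (a * c + alpha).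
  by rewrite factS natrM exprS; ring.
have -> : c ^+ n.+2 * n.+2`!%:R = c ^+ n * n.+1`!%:R * (c ^+ 2 * n.+2%:R).
  by rewrite (factS n.+1) natrM !exprS; ring.
apply: ler_wpM2l; first by rewrite mulr_ge0// exprn_ge0.
(* Since [1 <= c], one has [a * c + alpha <= (a + alpha) * c <= c ^+ 2]. *)
apply: (@le_trans _ _ (c ^+ 2)); first nra.
by rewrite ler_peMr ?exprn_ge0// ler1n.
Qed.

(* The recursion multiplies h_n / n! by O(1/n) at each step, so any eps is
   reached after finitely many steps. *)
Lemma hermite_bound_small {R : realType} (a alpha eps : R) :
  0 <= a -> 0 <= alpha -> 0 < eps ->
  exists2 M : R, 1 <= M & forall n, hermite_bound a alpha n <= M * eps ^+ n * n`!%:R.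
Proof.
(* The summands make [c] at least 1, at least [a + alpha] and at least [eps]; then [(c / eps) ^+ N]
   pays for replacing the rate [c] by [eps] up to order [N]. *)
move=> a0 alpha0 e0; have e0' := ltW e0; pose c := a + alpha + 1 + eps.
have c1 : 1 <= c by rewrite /c; lra.
have ce : 1 <= c / eps by rewrite ler_pdivlMr// mul1r /c; lra.
(* Beyond order [N] the induction step closes, because it amounts to
   [a * eps + alpha <= eps ^+ 2 * m.+2%:R]. *)
have [N HN] : exists N : nat, (a * eps + alpha) / eps ^+ 2 <= N%:R.
  exists (Num.bound ((a * eps + alpha) / eps ^+ 2)).
  apply: ltW; apply: archi_boundP.
  by rewrite divr_ge0 ?addr_ge0 ?mulr_ge0 ?exprn_ge0// ltW.
have M1 : 1 <= (c / eps) ^+ N by rewrite exprn_ege1.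
exists ((c / eps) ^+ N) => // n.
have small m : (m <= N)%N ->
    hermite_bound a alpha m <= (c / eps) ^+ N * eps ^+ m * m`!%:R.
  move=> mN; apply: (le_trans (@hermite_bound_geometric _ _ _ c m a0 alpha0 c1 _)).
    by rewrite /c; lra.
  apply: ler_wpM2r => //.
  have -> : c ^+ m = (c / eps) ^+ m * eps ^+ m by rewrite -exprMn divfK// gt_eqF.
  by apply: ler_wpM2r; [rewrite exprn_ge0// ltW|rewrite ler_weXn2l].
suff : hermite_bound a alpha n <= (c / eps) ^+ N * eps ^+ n * n`!%:R /\
       hermite_bound a alpha n.+1 <=
         (c / eps) ^+ N * eps ^+ n.+1 * n.+1`!%:R by case.
set M := (c / eps) ^+ N in small M1 *; have M0 : 0 <= M by apply: le_trans M1.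
have step m : hermite_bound a alpha m <= M * eps ^+ m * m`!%:R ->
   hermite_bound a alpha m.+1 <= M * eps ^+ m.+1 * m.+1`!%:R ->
   hermite_bound a alpha m.+2 <= M * eps ^+ m.+2 * m.+2`!%:R.
  move=> h1 h2; have [/small//|Nm] := leqP m.+2 N.
  rewrite hermite_boundSS.
  apply: (@le_trans _ _
    (a * (M * eps ^+ m.+1 * m.+1`!%:R) + alpha * m.+1%:R * (M * eps ^+ m * m`!%:R))).
    by apply: lerD; apply: ler_wpM2l; rewrite ?mulr_ge0.
  have -> : a * (M * eps ^+ m.+1 * m.+1`!%:R) +
      alpha * m.+1%:R * (M * eps ^+ m * m`!%:R) =
    M * eps ^+ m * m.+1`!%:R * (a * eps + alpha).
    by rewrite factS natrM exprS; ring.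
  have -> : M * eps ^+ m.+2 * m.+2`!%:R =
    M * eps ^+ m * m.+1`!%:R * (eps ^+ 2 * m.+2%:R).
    by rewrite (factS m.+1) natrM !exprS; ring.
  apply: ler_wpM2l.
    by apply: mulr_ge0 => //; apply: mulr_ge0 => //; exact: exprn_ge0.
  rewrite [leRHS]mulrC -ler_pdivrMr ?exprn_gt0//; apply: (le_trans HN).
  by rewrite ler_nat ltnW.
elim: n => [|n [IH1 IH2]]; last by split=> //; exact: step.
split; first by rewrite /= fact0 expr0 !mulr1.
(* Order 1 is not covered by [small] when [N = 0], but then [a * eps + alpha <= 0] forces
   [a <= 0]. *)
have [/small//|] := leqP 1 N; rewrite ltnS leqn0 => /eqP N0.
rewrite (erefl : 1`! = 1)%N /= mulr1 addr0 /M N0 expr0 expr1 mul1r mulr1.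
move: HN; rewrite N0 ler_pdivrMr ?exprn_gt0// mul0r => HN.
have : a * eps <= 0 by lra.
by rewrite pmulr_lle0// => ?; lra.
Qed.

Lemma gaussD_hermite_bound {R : realType} k (A : 'M[R]_k) (a alpha : R)
    (z : 'rV[R]_k) I :
  0 <= a -> 0 <= alpha -> (forall i j, `|A i j| <= alpha) ->
  (forall i, `|lform A i z| <= a) -> 0 <= qform A z ->
  `|gaussD A I z| <= hermite_bound a alpha (size I).
Proof.
move=> a0 al0 Aal la q0.
have [n nI] := ubnP (size I); elim: n I nI => // n IH [|i I] /= nI.
  by rewrite /gaussD /= ger0_norm ?expR_ge0// expR_le1
     mulNr oppr_le0 mulr_ge0// invr_ge0.
rewrite gaussD_cons (le_trans (ler_normB _ _))// lerD//.
  by rewrite normrM normrN ler_pM// IH.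
rewrite (le_trans (ler_norm_sum _ _ _))//.
have -> : match size I with
    | 0 => 0 | n''.+1 => alpha * (size I)%:R * hermite_bound a alpha n'' end =
   \sum_(p <- removals I) alpha * hermite_bound a alpha (size I).-1.
  rewrite big_const_seq count_predT size_removals iter_addr_0 -mulr_natr.
  by case: (size I) => [|m] /=; rewrite ?mulr0//; ring.
rewrite big_seq [leRHS]big_seq; apply: ler_sum => p /removals_size pI.
rewrite normrM ler_pM// -pI /=; apply: IH; rewrite -pI in nI.
exact: ltnW.
Qed.

(** * Factorials of sums *)

(** A multinomial coefficient is one term in the expansion of a power of 1 + ... + 1. The induction
    isolates one term of the binomial expansion of [n.+1 ^ (x + m)]. *)
Lemma fact_sumn_leq (s : seq nat) :
  ((sumn s)`! <= size s ^ sumn s * \prod_(x <- s) x`!)%N.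
Proof.
elim: s => [|x s IH] /=; first by rewrite big_nil.
set m := sumn s in IH *; set n := size s in IH *.
rewrite big_cons -(@bin_fact (x + m) x) ?leq_addr// addKn.
have Hbin : ('C(x + m, x) * n ^ m <= n.+1 ^ (x + m))%N.
  have xlt : (x < (x + m).+1)%N by rewrite ltnS leq_addr.
  rewrite -addn1 expnDn (bigD1 (Ordinal xlt)) //= exp1n muln1 addKn.
  exact: leq_addr.
apply: (@leq_trans ('C(x + m, x) * (x`! * (n ^ m * \prod_(y <- s) y`!)))).
  by rewrite !leq_mul2l IH !orbT.
have -> : ('C(x + m, x) * (x`! * (n ^ m * \prod_(y <- s) y`!)) =
  ('C(x + m, x) * n ^ m) * (x`! * \prod_(y <- s) y`!))%N by ring.
by rewrite leq_mul2r Hbin orbT.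
Qed.

Lemma fact_mlength_leq k (eta : {ffun 'I_k -> nat}) :
  ((mlength eta)`! <= k ^ mlength eta * mfact eta)%N.
Proof.
have := fact_sumn_leq [seq eta j | j <- enum 'I_k].
rewrite size_map size_enum_ord (_ : sumn _ = mlength eta).
  by rewrite big_map big_enum.
by rewrite sumnE big_map big_enum.
Qed.

Lemma factD_leq m n : ((m + n)`! <= 2 ^ (m + n) * (m`! * n`!))%N.
Proof.
have := fact_sumn_leq [:: m; n].
by rewrite /= addn0 !big_cons big_nil muln1.
Qed.

(** * Multi-indices as sorted lists *)

Lemma size_mindex_seq n (nu : {ffun 'I_n -> nat}) :
  size (mindex_seq nu) = mlength nu.
Proof.
rewrite /mindex_seq size_flatten /shape -map_comp sumnE big_map big_enum /=.
by apply: eq_bigr => j _; rewrite size_nseq.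
Qed.

Lemma prod_mindex_seq {R : realType} (b : R^nat) n (nu : {ffun 'I_n -> nat}) :
  \prod_(j <- mindex_seq nu) b j = mpow b nu.
Proof.
rewrite /mindex_seq big_flatten big_map big_enum /=.
by apply: eq_bigr => j _; rewrite big_nseq iter_mulr mulr1.
Qed.

Lemma sorted_mindex_seq n (nu : {ffun 'I_n -> nat}) :
  sorted (relpre val leq) (mindex_seq nu).
Proof.
rewrite sorted_pairwise; last by move=> ? ? ?; exact: leq_trans.
rewrite /mindex_seq; have : pairwise (relpre val leq) (enum 'I_n).
  rewrite -sorted_pairwise; last by move=> ? ? ?; exact: leq_trans.
  by rewrite -sorted_map val_enum_ord iota_sorted.
elim: (enum 'I_n) => //= i e IH /andP[ie pe].
rewrite pairwise_cat IH// andbT; apply/andP; split.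
  apply/allrelP => x y; rewrite mem_nseq => /andP[_ /eqP ->].
  move=> /flattenP[t /mapP[j je ->]]; rewrite mem_nseq => /andP[_ /eqP ->].
  by move/allP: ie; exact.
by elim: (nu i) => //= m ->; rewrite andbT all_nseq /= leqnn orbT.
Qed.

Lemma count_mindex_seq n (nu : {ffun 'I_n -> nat}) j :
  count_mem j (mindex_seq nu) = nu j.
Proof.
rewrite /mindex_seq count_flatten -map_comp sumnE big_map big_enum /=.
rewrite (bigD1 j)//= count_nseq /= eqxx mul1n big1 ?addn0// => i ij.
by rewrite count_nseq /= (negPf ij).
Qed.

(** A sublist of a sorted list is sorted, and a sorted list is determined by its multiplicities.
    Thus a bound on [mpartial] applies to the partial derivative along any sublist. *)
Lemma subseq_mindex_seq n (nu : {ffun 'I_n -> nat}) s : subseq s (mindex_seq nu) ->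
  s = mindex_seq [ffun j => count_mem j s].
Proof.
move=> snu; apply: (@sorted_eq _ (relpre val leq)).
- by move=> ? ? ?; exact: leq_trans.
- by move=> x y; rewrite /= -eqn_leq => /eqP/val_inj.
- by apply: subseq_sorted snu (sorted_mindex_seq nu) => ? ? ?; exact: leq_trans.
- exact: sorted_mindex_seq.
- by apply/allP => j _ /=; rewrite count_mindex_seq ffunE.
Qed.

(** * Combinatorics of Faa di Bruno's formula *)

Section faa_di_bruno.
Context {s k : nat}.
Implicit Types (j : 'I_s) (fs : seq (seq 'I_s * 'I_k)).

(* A list of pairs (S, i) stands for the product of the - d_S G_i times the
   derivative of F along the list of the i. *)
Fixpoint factor_derivs j fs :=
  if fs is f :: fs' then
    ((j :: f.1, f.2) :: fs') :: [seq f :: gs | gs <- factor_derivs j fs']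
  else [::].

(** Differentiating the derivative of F opens a block [[:: j]] for each coordinate of G;
    differentiating the product enlarges an existing block. New blocks go to the end to match
    [has_derive_gaussD]. *)
Definition monomial_derivs j fs :=
  [seq rcons fs ([:: j], i) | i <- enum 'I_k] ++ factor_derivs j fs.

(** Terms are listed with repetition instead of being collected with coefficients: one for each set
    partition of the positions of [l] with blocks labelled by coordinates of G. *)
Definition faa_di_bruno (l : seq 'I_s) : seq (seq (seq 'I_s * 'I_k)) :=
  foldr (fun j ms => flatten [seq monomial_derivs j fs | fs <- ms]) [:: [::]] l.

Definition blocks_size fs : nat := \sum_(f <- fs) size f.1.

Lemma factor_derivs_snd j fs gs :
  gs \in factor_derivs j fs -> map snd gs = map snd fs.
Proof.
elim: fs gs => //= f fs IH gs; rewrite in_cons.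
move=> /predU1P[-> //|/mapP[hs hsfs ->]] /=.
by rewrite (IH hs).
Qed.

Lemma factor_derivs_blocks_size j fs gs :
  gs \in factor_derivs j fs -> blocks_size gs = (blocks_size fs).+1.
Proof.
rewrite /blocks_size.
elim: fs gs => //= f fs IH gs; rewrite in_cons.
move=> /predU1P[-> //|/mapP[hs hsfs ->]] /=.
  by rewrite !big_cons.
by rewrite !big_cons (IH hs)// addnS.
Qed.

(** Nonemptiness bounds the number of blocks by the order of differentiation; being a sublist
    preserves sortedness. *)
Definition block_in (l : seq 'I_s) (f : seq 'I_s * 'I_k) :=
  (0 < size f.1)%N && subseq f.1 l.

Lemma block_in_cons j l f : block_in l f -> block_in (j :: l) f.
Proof.
by case/andP=> f0 fl; rewrite /block_in f0 (subseq_trans fl (subseq_cons _ _)).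
Qed.

Definition blocks_of l fs := (blocks_size fs == size l) && all (block_in l) fs.

Lemma factor_derivs_blocks j l fs gs : all (block_in l) fs ->
  gs \in factor_derivs j fs -> all (block_in (j :: l)) gs.
Proof.
elim: fs gs => //= f fs IH gs /andP[fl fsl].
rewrite in_cons => /predU1P[->|/mapP[hs hsfs ->]] /=.
  rewrite (sub_all (@block_in_cons j l) fsl) andbT /block_in /= eqxx.
  by case/andP: fl.
by rewrite block_in_cons//= IH.
Qed.

Lemma faa_di_bruno_blocks l fs : fs \in faa_di_bruno l -> blocks_of l fs.
Proof.
elim: l fs => [|j l IH] fs /=.
  by rewrite inE => /eqP ->; rewrite /blocks_of /blocks_size big_nil.
move=> /flattenP[t /mapP[gs /IH /andP[/eqP ol gl] ->]].
rewrite mem_cat => /orP[/mapP[i _ ->]|fsgs].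
  rewrite /blocks_of /blocks_size big_rcons /= addn1 -/(blocks_size gs).
  rewrite ol eqxx all_rcons.
  by rewrite (sub_all (@block_in_cons j l) gl) andbT /block_in /= eqxx sub0seq.
by rewrite /blocks_of (factor_derivs_blocks_size fsgs) ol eqxx
  (factor_derivs_blocks gl).
Qed.

Lemma size_blocks_of l fs : blocks_of l fs -> (size fs <= size l)%N.
Proof.
move=> /andP[/eqP <-]; rewrite /blocks_size.
elim: fs => //= f fs IH /andP[/andP[f0 _] fsl].
by rewrite big_cons -add1n leq_add// IH.
Qed.

End faa_di_bruno.

(** * Derivatives of the Gaussian composed with the forward map *)

Lemma has_derive_in_factors {R : realType} (s k : nat) (D : set 'rV[R]_s) x j
    (u : seq 'I_s * 'I_k -> 'rV[R]_s -> R) fs :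
  (forall f, has_derive_in D (delta_mx 0 j) (u f) x (u (j :: f.1, f.2) x)) ->
  has_derive_in D (delta_mx 0 j) (fun t => \prod_(f <- fs) u f t) x
    (\sum_(gs <- factor_derivs j fs) \prod_(f <- gs) u f x).
Proof.
move=> uj; elim: fs => [|f fs IH] /=.
  rewrite big_nil (_ : (fun t => _) = fun=> 1); first exact: has_derive_in_cst.
  by apply/funext => t; rewrite big_nil.
rewrite (_ : (fun t => _) = fun t => u f t * \prod_(f <- fs) u f t); last first.
  by apply/funext => t; rewrite big_cons.
rewrite big_cons big_map big_cons.
under [X in _ + X]eq_bigr do rewrite big_cons.
rewrite -mulr_sumr; exact: (has_derive_inM (uj f) IH).
Qed.

Section gaussian_of_map.
Context {R : realType} {s k : nat} (A : 'M[R]_k) (A_sym : A^T = A).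
Context (D : set 'rV[R]_s) (G : 'rV[R]_s -> 'rV[R]_k) (G_smooth : smooth_in D G).
Context (D_proper : forall x j, D x ->
  ProperFilter (increments_in D (delta_mx 0 j) x)).

(** The sign comes from the inner function y - G; the empty block gives - G itself. *)
Definition block_factor (f : seq 'I_s * 'I_k) (x : 'rV[R]_s) : R :=
  - partials D f.1 G x 0 f.2.

Definition monomial (y : 'rV[R]_k) (I : seq 'I_k) fs (x : 'rV[R]_s) : R :=
  (\prod_(f <- fs) block_factor f x) * gaussD A (map snd fs ++ I) (y - G x).

Lemma has_derive_in_factor f j x : D x ->
  has_derive_in D (delta_mx 0 j) (block_factor f) x (block_factor (j :: f.1, f.2) x).
Proof.
move=> Dx; apply: has_derive_inN; apply: has_derive_in_coord.
by have [_] := G_smooth f.1; exact.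
Qed.

Lemma has_derive_in_monomial y fs j x : D x ->
  has_derive_in D (delta_mx 0 j) (monomial y [::] fs) x
    (\sum_(gs <- monomial_derivs j fs) monomial y [::] gs x).
Proof.
move=> Dx; rewrite /monomial_derivs big_cat big_map /= addrC.
have -> : \sum_(gs <- factor_derivs j fs) monomial y [::] gs x =
  (\sum_(gs <- factor_derivs j fs) \prod_(f <- gs) block_factor f x) *
  gaussD A (map snd fs ++ [::]) (y - G x).
  rewrite mulr_suml; apply: eq_big_seq => gs /factor_derivs_snd gsE.
  by rewrite /monomial gsE.
have -> : \sum_(i <- enum 'I_k) monomial y [::] (rcons fs ([:: j], i)) x =
  (\prod_(f <- fs) block_factor f x) *
  \sum_i gaussD A (rcons (map snd fs ++ [::]) i) (y - G x) *
    block_factor ([:: j], i) x.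
  rewrite big_enum /= mulr_sumr; apply: eq_bigr => i _.
  by rewrite /monomial big_rcons map_rcons !cats0 /= -mulrA
    (mulrC (block_factor _ _)).
apply: has_derive_inM.
  by apply: has_derive_in_factors => f; exact: has_derive_in_factor.
apply: has_derive_gaussD => // i.
rewrite (_ : (fun t => _) = fun t => y 0 i + block_factor ([::], i) t); last first.
  by apply/funext => t; rewrite !mxE.
rewrite -[block_factor _ _]add0r.
by apply: has_derive_inD; [exact: has_derive_in_cst|exact: has_derive_in_factor].
Qed.

Lemma partials_gaussian y l x : D x ->
  partials D l (fun t => gaussD A [::] (y - G t) : R) x =
  \sum_(fs <- faa_di_bruno l) monomial y [::] fs x.
Proof.
elim: l x => [|j l IH] x Dx /=.
  by rewrite big_seq1 /monomial big_nil mul1r.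
apply: derive_in_has_derive; first exact: D_proper.
(* The induction hypothesis describes the inner partial derivative on [D] only. *)
apply: (@eq_has_derive_in _ _ D _
  (fun t => \sum_(fs <- faa_di_bruno l) monomial y [::] fs t)) => //.
  by move=> t; rewrite inE => Dt; rewrite IH.
rewrite big_flatten big_map.
by apply: has_derive_in_sum => fs _; exact: has_derive_in_monomial.
Qed.

(** The head of [l] is differentiated last and each new index is appended at the end, hence [rev].
    The later estimate depends on the length of this list only. *)
Lemma partials_setT_monomials ms l x y :
  partials setT l (fun y => \sum_(fs <- ms) monomial y [::] fs x : R) y =
  \sum_(fs <- ms) monomial y (rev l) fs x.
Proof.
elim: l y => // j l IH y /=.
apply: derive_in_has_derive; first exact: increments_in_setT_proper.
rewrite (_ : partials _ _ _ =
  fun y => \sum_(fs <- ms) monomial y (rev l) fs x); last first.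
  by apply/funext => z; rewrite IH.
apply: has_derive_in_sum => fs _; apply: has_derive_inZ.
rewrite rev_cons -rcons_cat.
have -> : gaussD A (rcons (map snd fs ++ rev l) j) (y - G x) =
  \sum_i gaussD A (rcons (map snd fs ++ rev l) i) (y - G x) * (i == j)%:R.
  rewrite (bigD1 j)//= eqxx mulr1 big1 ?addr0// => i /negPf ->.
  by rewrite mulr0.
apply: has_derive_gaussD => // i.
rewrite (_ : (fun t => _) = fun t : 'rV[R]_k => t 0 i + - G x 0 i); last first.
  by apply/funext => t; rewrite !mxE.
rewrite -[_%:R]addr0; apply: has_derive_inD; last exact: has_derive_in_cst.
exact: has_derive_in_proj.
Qed.

End gaussian_of_map.

(** * Total weight of the terms *)

Section weights.
Context {R : realType} (s k : nat) (C beta : R) (b : R^nat).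

Definition factor_weight (f : seq 'I_s * 'I_k) : R :=
  C * (size f.1)`!%:R `^ beta * \prod_(j <- f.1) b j.

(** The majorant of a term up to a constant and the factorial of eta. The power of [k] in the
    denominator cancels the [k] choices of a coordinate for each block. *)
Definition weight (fs : seq (seq 'I_s * 'I_k)) : R :=
  (size fs)`!%:R / k%:R ^+ size fs * \prod_(f <- fs) factor_weight f.

End weights.

(** Adding [j] to a block with q entries multiplies its weight by [b j] times the power [beta] of q
    + 1. *)
Lemma sum_factor_derivs_weight {R : realType} (s k : nat) (C beta : R) (b : R^nat)
    j (fs : seq (seq 'I_s * 'I_k)) :
  \sum_(gs <- factor_derivs j fs) \prod_(f <- gs) factor_weight C beta b f =
  b j * (\sum_(f <- fs) (size f.1).+1%:R `^ beta) *
    \prod_(f <- fs) factor_weight C beta b f.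
Proof.
elim: fs => [|f fs IH] /=; first by rewrite !big_nil mulr0 mul0r.
rewrite !big_cons big_map; under [X in _ + X]eq_bigr do rewrite big_cons.
rewrite -mulr_sumr IH {1}/factor_weight /= factS natrM powRM// big_cons.
set u := factor_weight C beta b f.
have -> : C * ((size f.1).+1%:R `^ beta * (size f.1)`!%:R `^ beta) *
   (b j * \prod_(j <- f.1) b j) = b j * (size f.1).+1%:R `^ beta * u.
  by rewrite /u /factor_weight; ring.
ring.
Qed.

Lemma powR_pred {R : realType} (x r : R) : 0 < x -> x `^ r = x * x `^ (r - 1).
Proof.
move=> x0; rewrite -{1}(subrK 1 r) [LHS]powRD; last by rewrite (gt_eqF x0) implybT.
by rewrite powRr1 ?ltW// mulrC.
Qed.

(** Keeping one factor [m] linear allows summation over blocks, whose total size is known. *)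
Lemma powRS_bound {R : realType} (beta : R) (m n : nat) : 1 <= beta -> (m <= n)%N ->
  m%:R `^ beta <= m%:R * n%:R `^ (beta - 1) :> R.
Proof.
move=> beta1 mn; have [->|m0] := posnP m.
  by rewrite mul0r powR0//; lra.
rewrite powR_pred ?ltr0n//.
apply: ler_wpM2l => //; apply: ge0_ler_powR; rewrite ?nnegrE ?ler_nat//; lra.
Qed.

(** Opening a block costs (m + 1) C, enlarging one costs at most (n + m) u in total, with u the
    power [beta - 1] of n + 1. As m <= n, these are at most one and two times C (n + 1) u, whence
    the 3. *)
Lemma sum_monomial_derivs_weight {R : realType} (s k : nat) (C beta : R) (b : R^nat)
    j (fs : seq (seq 'I_s * 'I_k)) l :
  (0 < k)%N -> 1 <= C -> 1 <= beta -> (forall j, 0 <= b j) -> blocks_of l fs ->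
  \sum_(gs <- monomial_derivs j fs) weight C beta b gs <=
  3 * C * b j * (size l).+1%:R `^ beta * weight C beta b fs.
Proof.
move=> k0 C1 beta1 b0 lfs.
have kn0 : k%:R != 0 :> R by rewrite pnatr_eq0 -lt0n.
have C0 : 0 <= C by apply: le_trans C1.
set n := size l; set m := size fs.
have mn : (m <= n)%N by exact: size_blocks_of lfs.
pose u : R := n.+1%:R `^ (beta - 1).
have nbeta : n.+1%:R `^ beta = n.+1%:R * u.
  by rewrite powR_pred ?ltr0n.
have u1 : 1 <= u.
  rewrite -(@powRr0 _ n.+1%:R) /u ler_powR ?ler1n//; lra.
have w0 : 0 <= weight C beta b fs.
  rewrite /weight mulr_ge0// ?divr_ge0// ?exprn_ge0//.
  by apply: prodr_ge0 => f _; rewrite !mulr_ge0 ?powR_ge0//; apply: prodr_ge0.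
have -> : \sum_(gs <- monomial_derivs j fs) weight C beta b gs =
  (m.+1%:R * C + \sum_(f <- fs) (size f.1).+1%:R `^ beta) * b j * weight C beta b fs.
  rewrite big_cat big_map /= big_enum /=.
  have -> : \sum_(gs <- factor_derivs j fs) weight C beta b gs =
    m`!%:R / k%:R ^+ m *
    \sum_(gs <- factor_derivs j fs) \prod_(f <- gs) factor_weight C beta b f.
    rewrite mulr_sumr; apply: eq_big_seq => gs /factor_derivs_snd/(congr1 size).
    by rewrite !size_map => gsm; rewrite /weight gsm.
  under eq_bigr do rewrite /weight big_rcons size_rcons /factor_weight /=
    big_seq1 (erefl : 1`! = 1)%N powR1 -/m.
  rewrite sumr_const card_ord sum_factor_derivs_weight /weight -/m -mulr_natr.
  rewrite factS natrM exprS; field.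
  by rewrite kn0 expf_neq0.
rewrite nbeta; apply: ler_wpM2r => //.
have -> : 3 * C * b j * (n.+1%:R * u) = 3 * C * (n.+1%:R * u) * b j by ring.
apply: ler_wpM2r => //.
(* The block sizes add up to [n], and each of the [m] blocks contributes one more. *)
have : \sum_(f <- fs) (size f.1).+1%:R `^ beta <= (n%:R + m%:R) * u.
  apply: (@le_trans _ _ (\sum_(f <- fs) (size f.1).+1%:R * u)).
    rewrite big_seq [leRHS]big_seq; apply: ler_sum => f ffs.
    apply: powRS_bound => //; rewrite ltnS.
    have /andP[_ /allP /(_ f ffs) /andP[_ /size_subseq]] := lfs; exact.
  rewrite -mulr_suml; apply: ler_wpM2r; first exact: powR_ge0.
  have /andP[/eqP ol _] := lfs; rewrite /n -ol /blocks_size /m.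
  rewrite -sum1_size -natrD -big_split /= -natr_sum ler_nat.
  by under [leqRHS]eq_bigr do rewrite addn1.
have : m%:R <= n%:R :> R by rewrite ler_nat.
rewrite -(@natr1 _ n) -(@natr1 _ m); have : 0 <= m%:R :> R by [].
move: (n%:R) (m%:R) => N M M0 MN h.
have NuC : (N + 1) * 1 * 1 <= (N + 1) * u * C.
  by apply: ler_pM => //; [lra|apply: ler_wpM2l => //; lra].
have uC : (N + 1) * C <= (N + 1) * u * C.
  by apply: ler_wpM2r => //; rewrite ler_peMr//; lra.
have NMu : (N + M) * u <= 2 * (N + 1) * u by apply: ler_wpM2r; lra.
have Nu : (N + 1) * u <= (N + 1) * u * C.
  by rewrite ler_peMr// mulr_ge0//; lra.
have MC : (M + 1) * C <= (N + 1) * C by apply: ler_wpM2r => //; lra.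
have -> : 3 * C * ((N + 1) * u) = 3 * ((N + 1) * u * C) by ring.
have : 2 * (N + 1) * u <= 2 * ((N + 1) * u * C) by rewrite -mulrA; apply: ler_wpM2l.
lra.
Qed.

Lemma sum_faa_di_bruno_weight {R : realType} (s k : nat) (C beta : R) (b : R^nat)
    (l : seq 'I_s) :
  (0 < k)%N -> 1 <= C -> 1 <= beta -> (forall j, 0 <= b j) ->
  \sum_(fs <- faa_di_bruno l) @weight R s k C beta b fs <=
  (3 * C) ^+ size l * (size l)`!%:R `^ beta * \prod_(j <- l) b j.
Proof.
move=> k0 C1 beta1 b0; elim: l => [|j l IH] /=.
  by rewrite big_seq1 /weight !big_nil fact0 powR1 expr0 !mulr1 divr1.
rewrite big_flatten big_map.
apply: (@le_trans _ _ (\sum_(fs <- @faa_di_bruno s k l)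
   3 * C * b j * (size l).+1%:R `^ beta * weight C beta b fs)).
  rewrite big_seq [leRHS]big_seq; apply: ler_sum => fs /faa_di_bruno_blocks lfs.
  exact: sum_monomial_derivs_weight.
rewrite -mulr_sumr big_cons factS natrM powRM// exprS.
apply: le_trans (ler_wpM2l _ IH) _.
  by rewrite !mulr_ge0 ?powR_ge0//; lra.
rewrite le_eqVlt; apply/orP; left; apply/eqP; ring.
Qed.

(** * Norms and positive definite matrices *)

Lemma coord_le_enorm {R : realType} n (x : 'rV[R]_n) i : `|x 0 i| <= enorm x.
Proof.
rewrite -sqrtr_sqr /enorm ler_sqrt; last by apply: sumr_ge0 => j _; exact: sqr_ge0.
by rewrite (bigD1 i)//= lerDl; apply: sumr_ge0 => j _; exact: sqr_ge0.
Qed.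

Lemma qformE {R : realType} k (A : 'M[R]_k) z : qform A z = (z *m A *m z^T) 0 0.
Proof.
rewrite /qform /lform mxE.
under [RHS]eq_bigr do rewrite !mxE mulr_suml.
rewrite [RHS]exchange_big /=; apply: eq_bigr => i _; rewrite mulr_sumr.
by apply: eq_bigr => j _; rewrite mulrA.
Qed.

Lemma posdefmx_unit {R : realType} k (A : 'M[R]_k) : posdefmx A -> A \in unitmx.
Proof.
move=> [_ Apos]; rewrite -row_free_unit -kermx_eq0; apply/rowV0P => v.
move=> /sub_kermxP vA; apply/eqP; apply: contraT => /Apos.
by rewrite vA mul0mx mxE ltxx.
Qed.

(** The form of the inverse at [z] is the form of [A] at [z *m invmx A]. *)
Lemma posdefmx_invmx {R : realType} k (A : 'M[R]_k) : posdefmx A ->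
  (invmx A)^T = invmx A /\ forall z, 0 <= qform (invmx A) z.
Proof.
move=> /[dup] /posdefmx_unit Au [AT Apos].
have ATi : (invmx A)^T = invmx A by rewrite trmx_inv AT.
split=> // z; rewrite qformE.
have -> : z *m invmx A *m z^T = (z *m invmx A) *m A *m (z *m invmx A)^T.
  by rewrite trmx_mul ATi mulmxKV// mulmxA.
have [->|/Apos/ltW//] := eqVneq (z *m invmx A) 0.
by rewrite !mul0mx mxE.
Qed.

Lemma wnorm_invmx {R : realType} k (A : 'M[R]_k) z : posdefmx A ->
  wnorm (invmx A) z ^+ 2 = qform (invmx A) z.
Proof.
by move=> /posdefmx_invmx[_ A0]; rewrite /wnorm sqr_sqrtr -qformE.
Qed.

(** * Estimate of a single term and the final bound *)

Lemma gaussD_bounded {R : realType} k (A : 'M[R]_k) (L eps : R) :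
  0 <= L -> 0 < eps ->
  (forall z, 0 <= qform A z) ->
  exists2 M : R, 1 <= M & forall z : 'rV[R]_k, (forall i, `|z 0 i| <= L) ->
    forall I, `|gaussD A I z| <= M * eps ^+ size I * (size I)`!%:R.
Proof.
(* One number dominates both the entries and the absolute row sums, so the linear forms are at most
   [al * L]. *)
move=> L0 e0 A0; pose al : R := \sum_i \sum_j `|A i j|.
have al0 : 0 <= al by apply: sumr_ge0 => i _; exact: sumr_ge0.
have row_al i : \sum_j `|A i j| <= al.
  by rewrite /al [leRHS](bigD1 i)//= lerDl; apply: sumr_ge0 => ? _; exact: sumr_ge0.
have [M M1 HM] := hermite_bound_small (mulr_ge0 al0 L0) al0 e0.
exists M => // z zL I; apply: le_trans (HM _).
apply: gaussD_hermite_bound => //; first exact: mulr_ge0.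
  move=> i j; apply: le_trans (row_al i).
  by rewrite (bigD1 j)//= lerDl; exact: sumr_ge0.
move=> i; apply: (le_trans (ler_norm_sum _ _ _)).
apply: (@le_trans _ _ (\sum_j `|A i j| * L)).
  by apply: ler_sum => j _; rewrite normrM ler_wpM2l.
by rewrite -mulr_suml ler_wpM2r.
Qed.

Lemma monomial_bound {R : realType} s k (A : 'M[R]_k) (D : set 'rV[R]_s)
    (G : 'rV[R]_s -> 'rV[R]_k) (M C beta : R) (b : R^nat) l fs y
    (eta : {ffun 'I_k -> nat}) x :
  (0 < k)%N -> 0 <= M ->
  (forall I, `|gaussD A I (y - G x)| <=
    M * (2 * k%:R)^-1 ^+ size I * (size I)`!%:R) ->
  (forall S i, subseq S l ->
    `|partials D S G x 0 i| <= C * (size S)`!%:R `^ beta * \prod_(j <- S) b j) ->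
  blocks_of l fs ->
  `|monomial A D G y (rev (mindex_seq eta)) fs x| <=
    M * (mfact eta)%:R * weight C beta b fs.
Proof.
move=> k0 M0 Fb Gb /andP[_ lfs].
have kp : 0 < k%:R :> R by rewrite ltr0n.
rewrite /monomial /weight normrM normr_prod.
set e := mlength eta; set m := size fs.
have P0 : 0 <= \prod_(f <- fs) `|block_factor D G f x| by exact: prodr_ge0.
have Pw : \prod_(f <- fs) `|block_factor D G f x| <=
    \prod_(f <- fs) factor_weight C beta b f.
  rewrite big_seq [leRHS]big_seq; apply: ler_prod => f ffs; rewrite normr_ge0 /=.
  by rewrite /block_factor normrN Gb//; move/allP: lfs => /(_ f ffs)/andP[].
have gw : `|gaussD A (map snd fs ++ rev (mindex_seq eta)) (y - G x)| <=
    M * (mfact eta)%:R * (m`!%:R / k%:R ^+ m).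
  apply: (le_trans (Fb _)).
  rewrite size_cat size_map size_rev size_mindex_seq -/e -/m.
  (* Splitting the factorial of [m + e] costs a power of 2 and passing to [mfact eta] costs [k ^ e];
     the rate 1 / (2k) cancels both and leaves [k%:R ^+ m] in the denominator. *)
  apply: (@le_trans _ _ (M * (2 * k%:R)^-1 ^+ (m + e) *
     (2 ^+ (m + e) * (m`!%:R * (k%:R ^+ e * (mfact eta)%:R))))).
    apply: ler_wpM2l.
      by rewrite mulr_ge0// exprn_ge0// invr_ge0 mulr_ge0// ltW.
    rewrite -!natrX -!natrM ler_nat; apply: (leq_trans (factD_leq _ _)).
    by rewrite !leq_mul// fact_mlength_leq.
  rewrite exprVn exprMn (exprD k%:R) le_eqVlt; apply/orP; left; apply/eqP; field.
  by rewrite !expf_neq0 ?gt_eqF.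
rewrite [leRHS]mulrA [leRHS]mulrC; exact: ler_pM.
Qed.

Theorem lemma5p6 (R : realType) (k : nat) (k_gt0 : (0 < k)%N)
    (K : R) (K_gt0 : 0 < K)
    (d : nat) (Xi : set 'rV[R]_d) (Xi_compact : compact Xi)
    (Gamma : 'M[R]_k) (Gamma_posdef : posdefmx Gamma)
    (mu_min : R) (mu_min_gt0 : 0 < mu_min) (mu_min_le1 : mu_min <= 1)
    (mu_min_eigen : forall a : R, eigenvalue Gamma a -> mu_min <= a)
    (C : R) (C_ge1 : 1 <= C) (beta : R) (beta_ge1 : 1 <= beta)
    (b : R^nat) (b_ge0 : forall j, 0 <= b j)
    (p : R) (p_gt0 : 0 < p) (p_lt1 : p < 1) (b_lp : lp_seq p b)
    (G : forall s : nat, 'rV[R]_s -> 'rV[R]_d -> 'rV[R]_k)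
    (G_smooth : forall s : nat, (0 < s)%N -> forall xi, Xi xi ->
       smooth_in (cube (2^-1)) (fun theta => G s theta xi))
    (G_bound : forall s : nat, (0 < s)%N ->
       forall (theta : 'rV[R]_s) (nu : {ffun 'I_s -> nat}) (xi : 'rV[R]_d),
       cube (2^-1) theta -> Xi xi ->
       enorm (mpartial (cube (2^-1)) nu (fun t => G s t xi) theta)
         <= C * ((mlength nu)`!)%:R `^ beta * mpow b nu) :
  exists2 r : R, 1 <= r &
    forall s : nat, (0 < s)%N ->
    forall (nu : {ffun 'I_s -> nat}) (eta : {ffun 'I_k -> nat}),
    nu != 0 -> eta != 0 ->
    forall (theta : 'rV[R]_s) (y : 'rV[R]_k) (xi : 'rV[R]_d),
    cube (2^-1) theta -> cube K y -> Xi xi ->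
    `| mpartial setT eta
         (fun y' : 'rV[R]_k =>
            mpartial (cube (2^-1)) nu
              (fun theta' : 'rV[R]_s =>
                 expR (- 2^-1 * wnorm (invmx Gamma) (y' - G s theta' xi) ^+ 2)
                 : R) theta) y |
    <= (11 / 10) ^+ k * 2 `^ (beta * (k%:R - 1)) * k%:R * expR (2 * k%:R)
       * (mfact eta)%:R * (4 `^ beta * C) ^+ mlength nu
       * mu_min `^ (- (mlength nu)%:R - 2^-1) * r ^+ mlength nu
       * ((mlength nu)`!)%:R `^ beta * mpow b nu.
Proof.
have [A_sym A_psd] := posdefmx_invmx Gamma_posdef.
set A := invmx Gamma in A_sym A_psd *.
have C0 : 0 <= C by apply: le_trans C_ge1.
have L0 : 0 <= K + C by rewrite addr_ge0// ltW.
have kp : 0 < k%:R :> R by rewrite ltr0n.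
have e0 : 0 < (2 * k%:R)^-1 :> R by rewrite invr_gt0 mulr_gt0.
have [M M1 HM] := gaussD_bounded L0 e0 A_psd.
have M0 : 0 <= M by apply: le_trans M1.
(* The 3 is the growth rate of the weights; [M] bounds the Gaussian derivatives for coordinates up
   to [K + C] and is fixed before [s], [theta] and [xi]. *)
exists (3 * M); first by lra.
move=> s s0 nu eta nu0 eta0 theta y xi theta_cube y_cube Xi_xi.
set Gxi := fun t => G s t xi.
set l := mindex_seq nu; set D : set 'rV[R]_s := cube 2^-1.
have D_proper x j : D x -> ProperFilter (increments_in D (delta_mx 0 j) x).
  by apply: increments_in_cube_proper; rewrite invr_gt0.
have Gb S i : subseq S l ->
    `|partials D S Gxi theta 0 i| <= C * (size S)`!%:R `^ beta * \prod_(j <- S) b j.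
  move=> /subseq_mindex_seq ->; rewrite size_mindex_seq prod_mindex_seq.
  exact: le_trans (coord_le_enorm _ _) (G_bound s s0 theta _ xi theta_cube Xi_xi).
have -> : (fun y' => mpartial D nu (fun t =>
      expR (- 2^-1 * wnorm A (y' - G s t xi) ^+ 2) : R) theta) =
    (fun y' => \sum_(fs <- faa_di_bruno l) monomial A D Gxi y' [::] fs theta).
  apply/funext => y'; rewrite -partials_gaussian//; last exact: G_smooth.
  by congr (partials _ _ _ _); apply/funext => t; rewrite wnorm_invmx.
rewrite /mpartial partials_setT_monomials//.
have Fb I : `|gaussD A I (y - Gxi theta)| <=
    M * (2 * k%:R)^-1 ^+ size I * (size I)`!%:R.
  apply: HM => i; rewrite !mxE; apply: (le_trans (ler_normB _ _)); apply: lerD.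
    by rewrite ler_norml y_cube.
  (* The bound of order zero says that the coordinates of G are at most [C]. *)
  have := Gb [::] i (sub0seq _); rewrite /= fact0 powR1 big_nil !mulr1; exact.
set n := mlength nu.
have sum_bound : `|\sum_(fs <- faa_di_bruno l)
      monomial A D Gxi y (rev (mindex_seq eta)) fs theta| <=
    M * (mfact eta)%:R * ((3 * C) ^+ n * n`!%:R `^ beta * mpow b nu).
  apply: (le_trans (ler_norm_sum _ _ _)).
  apply: (@le_trans _ _ (\sum_(fs <- @faa_di_bruno s k l)
      M * (mfact eta)%:R * weight C beta b fs)).
    rewrite big_seq [leRHS]big_seq; apply: ler_sum => fs /faa_di_bruno_blocks lfs.
    exact: monomial_bound lfs.
  rewrite -mulr_sumr; apply: ler_wpM2l; first by rewrite mulr_ge0.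
  by rewrite /n -size_mindex_seq -prod_mindex_seq; exact: sum_faa_di_bruno_weight.
apply: (le_trans sum_bound).
(* A nonzero [nu] makes [n] positive, so the single factor [M] is absorbed by [M ^+ n]. *)
have n0 : (0 < n)%N.
  rewrite lt0n; apply: contra nu0 => /eqP nE; apply/eqP/ffunP => j; rewrite ffunE.
  by apply/eqP; move/eqP: nE; rewrite /n /mlength sum_nat_eq0 => /forallP/(_ j).
have M_Mn : M <= M ^+ n by rewrite -[leLHS]expr1 ler_weXn2l.
have pow4 : 1 <= 4 `^ beta :> R.
  by rewrite -[leLHS](@powRr0 _ 4) ler_powR//; lra.
have C4n : C ^+ n <= (4 `^ beta * C) ^+ n.
  by apply: lerXn2r; rewrite ?nnegrE ?mulr_ge0 ?powR_ge0// ler_peMl.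
(* The remaining factors of the claimed bound are each at least 1; for the power of [mu_min] this
   follows from [mu_min <= 1] and the negative exponent. *)
have c1 : 1 <= (11 / 10) ^+ k :> R by rewrite exprn_ege1//; lra.
have c2 : 1 <= 2 `^ (beta * (k%:R - 1)) :> R.
  rewrite -[leLHS](@powRr0 _ 2) ler_powR//; first lra.
  by rewrite mulr_ge0 ?subr_ge0 ?ler1n//; lra.
have c3 : 1 <= k%:R :> R by rewrite ler1n.
have c4 : 1 <= expR (2 * k%:R) :> R by rewrite -expR0 ler_expR mulr_ge0.
have c5 : 1 <= mu_min `^ (- n%:R - 2^-1).
  have -> : - n%:R - 2^-1 = - (n%:R + 2^-1) :> R by ring.
  rewrite powRN invf_ge1 ?powR_gt0//.
  suff : mu_min `^ (n%:R + 2^-1) <= 1 `^ (n%:R + 2^-1) by rewrite powR1.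
  have r0 : 0 <= n%:R + 2^-1 :> R by rewrite addr_ge0// invr_ge0.
  by apply: ge0_ler_powR; rewrite ?nnegrE// ltW.
have EWB0 : 0 <= (mfact eta)%:R * n`!%:R `^ beta * mpow b nu.
  rewrite !mulr_ge0 ?powR_ge0//; apply: prodr_ge0 => j _; exact: exprn_ge0.
rewrite (exprMn n 3 C) (exprMn n 3 M).
have Cn0 : 0 <= C ^+ n by exact: exprn_ge0.
set t1 := (11 / 10) ^+ k in c1 *; set t2 := 2 `^ (beta * (k%:R - 1)) in c2 *.
set t3 := k%:R in c3 *; set t4 := expR (2 * t3) in c4 *.
set t5 := mu_min `^ _ in c5 *; set C4 := (4 `^ beta * C) ^+ n in C4n *.
set E := (mfact eta)%:R in EWB0 *; set W := n`!%:R `^ beta in EWB0 *.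
set B := mpow b nu in EWB0 *; set T := (3 ^+ n : R).
have T0 : 0 <= T by exact: exprn_ge0.
have -> : M * E * (T * C ^+ n * W * B) = 1 * (C ^+ n * (T * M) * (E * W * B)).
  by ring.
have -> : t1 * t2 * t3 * t4 * E * C4 * t5 * (T * M ^+ n) * W * B =
  t1 * t2 * t3 * t4 * t5 * (C4 * (T * M ^+ n) * (E * W * B)) by ring.
have p1 : 1 <= t1 * t2 * t3 * t4 * t5.
  by rewrite !mulr_ege1.
apply: ler_pM => //.
  by apply: mulr_ge0 => //; apply: mulr_ge0 => //; exact: mulr_ge0.
apply: ler_wpM2r => //; apply: ler_pM => //; first exact: mulr_ge0.
exact: ler_wpM2l.
Qed.
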